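(* Let $a,b\ge1$ be integers. The order of $K\text{-}\mathrm{Pro}$ on $\mathrm{Inc}^{a+b}(a\times b)$ is $a+b$; that is, $a+b$ is the smallest positive integer $m$ such that $(K\text{-}\mathrm{Pro})^m$ is the identity on $\mathrm{Inc}^{a+b}(a\times b)$.
   Context: **Increasing tableaux.** An increasing tableau of shape $a\times b$ is a filling of the rectangle with $a$ rows and $b$ columns by positive integers that strictly increase from left to right along rows and from top to bottom down columns. $\mathrm{Inc}^q(a\times b)$ is the set of those with all entries at most $q$ (not every integer in $\{1,\dots,q\}$ need appear). **$K$-promotion.** For $T\in\mathrm{Inc}^q(a\times b)$, delete all labels $1$. Then for $i=2,3,\dots,q$ in turn, consider the set of boxes that are currently empty or contain $i$, and decompose it into connected components (adjacency = sharing an edge). In each component with more than one box, simultaneously delete every label $i$ and place $i$ in every box that was empty; leave one-box components unchanged. Finally, fill the remaining empty boxes with $q+1$ and subtract $1$ from every entry. The result is $K\text{-}\mathrm{Pro}(T)\in\mathrm{Inc}^q(a\times b)$. $K\text{-}\mathrm{Pro}$ is a bijection of $\mathrm{Inc}^q(a\times b)$. *)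

(* Defs.v *)
From mathcomp Require Import all_boot.

Set Implicit Arguments.
Unset Strict Implicit.
Unset Printing Implicit Defensive.

Definition box (a b : nat) := ('I_a * 'I_b)%type.

Definition filling (a b : nat) := {ffun box a b -> nat}.

Definition partial_filling (a b : nat) := {ffun box a b -> option nat}.

Definition increasing_tableau (a b : nat) (T : filling a b) : Prop :=
  [/\ forall x : box a b, 0 < T x,
      forall (r : 'I_a) (c c' : 'I_b), c < c' -> T (r, c) < T (r, c')
    & forall (r r' : 'I_a) (c : 'I_b), r < r' -> T (r, c) < T (r', c)].

Definition Inc (q a b : nat) (T : filling a b) : Prop :=
  increasing_tableau T /\ forall x : box a b, T x <= q.

Definition adjacent (a b : nat) : rel (box a b) := fun x y =>
  ((x.1 == y.1) && ((x.2.+1 == y.2 :> nat) || (y.2.+1 == x.2 :> nat)))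
  || ((x.2 == y.2) && ((x.1.+1 == y.1 :> nat) || (y.1.+1 == x.1 :> nat))).

Definition active (a b i : nat) (P : partial_filling a b) : pred (box a b) :=
  fun x => (P x == None) || (P x == Some i).

(* For x active this is the connected component of x among active boxes;
   for x inactive it is just [set x], as connect is reflexive. *)
Definition component (a b i : nat) (P : partial_filling a b) (x : box a b) :
    {set box a b} :=
  [set y | connect
     (fun u v => [&& active i P u, active i P v & adjacent u v]) x y].

Definition K_step (a b : nat) (P : partial_filling a b) (i : nat) :
    partial_filling a b :=
  [ffun x => if active i P x && (1 < #|component i P x|)
             then (if P x == None then Some i else None)
             else P x].

Definition delete_ones (a b : nat) (T : filling a b) : partial_filling a b :=
  [ffun x => if T x == 1 then None else Some (T x)].

(* iota 2 q.-1 is the list 2, 3, ..., q. *)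
Definition K_Pro (q a b : nat) (T : filling a b) : filling a b :=
  let P := foldl (@K_step a b) (delete_ones T) (iota 2 q.-1) in
  [ffun x => (odflt q.+1 (P x)).-1].

Definition has_order_on (X : Type) (D : X -> Prop) (f : X -> X) (n : nat) :
    Prop :=
  [/\ 0 < n,
      forall x, D x -> iter n f x = x
    & forall m, 0 < m -> (forall x, D x -> iter m f x = x) -> n <= m].

(* Main.v *)
Require Import Defs.
From mathcomp Require Import all_boot.
From mathcomp Require Import zify.

(** Why the order is a + b.

    Write rank (i, j) = i + j, with coordinates starting at 0.  Strict
    monotonicity forces the entry of T at u to be rank u + 1 or rank u + 2, so
    T is the same thing as an order ideal of the product of chains a x b: the
    boxes where the smaller value occurs (in_ideal).  Call its maximal boxes
    the corners of T.

    During K-promotion each box u holds T u, is then empty for a while, and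
    finally receives its last value, which is rank u + 2, or rank u + 3 when u
    lies weakly above some corner.  This gives a closed form (phase) of every
    intermediate filling; checking it is a local matter, because a component
    has more than one box exactly when its boxes have an active neighbour
    (K_stepE, phase_step).  Hence K_Pro sends the ideal of T to the complement
    of the filter generated by the corners of T (in_ideal_K_Pro): K-promotion
    is inverse rowmotion on order ideals.

    Rowmotion on a product of two chains is a rotation in disguise, as shown by
    the Stanley-Thomas word.  Here the word of T has a letters telling which
    rows contain a corner, followed by b letters telling which columns contain
    none.  The corners of T are the minimal boxes outside the ideal of K_Pro T.
    In a partition, row i + 1 has a minimal outside box exactly when row i has
    a corner, and likewise for columns; the first row has no minimal outside
    box exactly when the last column has a corner, and the first column has
    none exactly when the last row has a corner.  So K_Pro rotates the word by
    one letter (word_K_Pro).  The word determines T (word_inj), whence the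
    (a + b)-th power of K_Pro is the identity; and the word of the empty ideal,
    a letters false followed by b letters true, is fixed by no shorter
    rotation (rotation_period). *)
Set Implicit Arguments.
Unset Strict Implicit.
Unset Printing Implicit Defensive.

(** * The product of two chains as a graded poset *)

Definition rank a b (u : box a b) : nat := u.1 + u.2.

Definition ble a b : rel (box a b) :=
  fun u v => (u.1 <= v.1) && (u.2 <= v.2).

Lemma ble_refl a b (u : box a b) : ble u u.
Proof. by rewrite /ble !leqnn. Qed.

Lemma ble_trans a b : transitive (@ble a b).
Proof. by move=> v u w; rewrite /ble; lia. Qed.

Lemma box_eq a b (u v : box a b) :
  u.1 = v.1 :> nat -> u.2 = v.2 :> nat -> u = v.
Proof.
by case: u v => [i j] [k l] /= /val_inj -> /val_inj ->.
Qed.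

Lemma rank_lt a b (u : box a b) : (rank u).+2 <= a + b.
Proof. by rewrite /rank; have := ltn_ord u.1; have := ltn_ord u.2; lia. Qed.

Lemma ble_pred a b (c u : box a b) : ble c u -> c != u ->
  exists v, [/\ ble c v, ble v u & rank u = (rank v).+1].
Proof.
case: c u => [i j] [k l]; rewrite /ble /rank /= => /andP[ik jl] neq.
have [ltik|leki] := ltnP i k.
  have kP : k.-1 < a by have := ltn_ord k; lia.
  by exists (Ordinal kP, l) => /=; split; lia.
have ltjl : j < l.
  rewrite ltn_neqAle jl andbT; apply: contraNneq neq => ejl.
  by apply/eqP/box_eq => /=; lia.
have lP : l.-1 < b by have := ltn_ord l; lia.
by exists (k, Ordinal lP) => /=; split; lia.
Qed.

Lemma ble_succ a b (u c : box a b) : ble u c -> u != c ->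
  exists v, [/\ ble u v, ble v c & rank v = (rank u).+1].
Proof.
case: u c => [i j] [k l]; rewrite /ble /rank /= => /andP[ik jl] neq.
have [ltik|leki] := ltnP i k.
  have kP : i.+1 < a by have := ltn_ord k; lia.
  by exists (Ordinal kP, j) => /=; split; lia.
have ltjl : j < l.
  rewrite ltn_neqAle jl andbT; apply: contraNneq neq => ejl.
  by apply/eqP/box_eq => /=; lia.
have lP : j.+1 < b by have := ltn_ord l; lia.
by exists (i, Ordinal lP) => /=; split; lia.
Qed.

Lemma adjacentE a b (u v : box a b) :
  adjacent u v = (ble u v && (rank v == (rank u).+1))
              || (ble v u && (rank u == (rank v).+1)).
Proof.
case: u v => [i j] [k l]; rewrite /adjacent /ble /rank /= -!(inj_eq val_inj) /=.
by lia.
Qed.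

(** * One step of K-promotion is local *)

Lemma component_gt1 a b i (P : partial_filling a b) x : active i P x ->
  (1 < #|component i P x|) = [exists y, active i P y && adjacent x y].
Proof.
move=> Px; apply/card_gt1P/existsP.
  case=> y [z [xy xz yz]].
  have [w ww xw] : exists2 w, w != x & w \in component i P x.
    case: (eqVneq y x) yz => [->|yx _]; last by exists y.
    by exists z; rewrite // eq_sym.
  move: xw; rewrite inE => /connectP[[|w' p] /= + ew].
    by move: ww; rewrite ew eqxx.
  by case/andP=> /and3P[_ Pw' aw'] _; exists w'; rewrite Pw'.
case=> y /andP[Py xy]; exists x, y; split.
- by rewrite inE connect0.
- by rewrite inE; apply: connect1; rewrite Px Py.
- by apply: contraTneq xy => ->; rewrite adjacentE; lia.
Qed.

(** Only the neighbours of a box decide what happens to it: connected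
    components need not be followed any further. *)
Lemma K_stepE a b (P : partial_filling a b) i x :
  K_step P i x = if active i P x && [exists y, active i P y && adjacent x y]
                 then (if P x == None then Some i else None) else P x.
Proof.
by rewrite ffunE; case Px: (active i P x) => //=; rewrite component_gt1.
Qed.

(** * Tableaux as order ideals *)

Definition in_ideal a b (T : filling a b) : pred (box a b) :=
  fun u => T u == (rank u).+1.

Definition corner a b (T : filling a b) : pred (box a b) :=
  fun u => in_ideal T u && [forall v, in_ideal T v && ble u v ==> (v == u)].

Definition above_corner a b (T : filling a b) : pred (box a b) :=
  fun u => [exists c, corner T c && ble c u].

(** The label of u just before the final subtraction: a box still empty at the
    end is the last one, and its refill is a + b + 1. *)
Definition refill a b (T : filling a b) (u : box a b) : nat :=
  (rank u).+2 + above_corner T u.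

(** The filling after labels 1, ..., i have been processed: u is empty from
    time T u until time refill T u, and if these agree it never becomes
    empty. *)
Definition phase a b (T : filling a b) (i : nat) : partial_filling a b :=
  [ffun u => if i < T u then Some (T u)
             else if i < refill T u then None else Some (refill T u)].

Lemma increasing_ble a b (T : filling a b) (u v : box a b) :
  increasing_tableau T -> ble u v -> T u + rank v <= T v + rank u.
Proof.
case=> _ incr incc.
have [n] := ubnP (rank v); elim: n v => // n IHn v ltvn uv.
have [->|neq] := eqVneq u v; first by [].
have [w [uw wv rv]] := ble_pred uv neq.
have ltw : T w < T v.
  case: w v wv rv {ltvn uv neq uw} => [i j] [k l].
  rewrite /ble /rank /= => ijkl rv.
  have [eik|neik] := eqVneq i k.
    by rewrite eik; apply: incr; move: rv; rewrite eik; lia.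
  have nik : i <> k :> nat by move=> e; case/eqP: neik; apply: val_inj.
  have -> : j = l by apply: val_inj => /=; lia.
  by apply: incc; lia.
by have := IHn w; rewrite uw; lia.
Qed.

(** The bounds come from a saturated chain through u: it takes rank u steps
    from the first box, and a + b - 2 - rank u steps to the last one. *)
Lemma Inc_bounds a b (T : filling a b) (u : box a b) : Inc (a + b) T ->
  rank u < T u <= (rank u).+2.
Proof.
case=> incT leT.
have a0 : 0 < a by have := ltn_ord u.1; lia.
have b0 : 0 < b by have := ltn_ord u.2; lia.
have a1 : a.-1 < a by lia.
have b1 : b.-1 < b by lia.
have bot : ble (Ordinal a0, Ordinal b0) u by [].
have top : ble u (Ordinal a1, Ordinal b1).
  by rewrite /ble /=; have := ltn_ord u.1; have := ltn_ord u.2; lia.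
have := increasing_ble incT bot; have := increasing_ble incT top.
have := leT (Ordinal a1, Ordinal b1).
case: incT => /(_ (Ordinal a0, Ordinal b0)) + _ _.
by rewrite /rank /=; lia.
Qed.

Lemma Inc_entry a b (T : filling a b) (u : box a b) : Inc (a + b) T ->
  T u = (rank u).+1 + ~~ in_ideal T u.
Proof. by move/(Inc_bounds u); rewrite /in_ideal; lia. Qed.

Lemma in_ideal_down a b (T : filling a b) (u v : box a b) : Inc (a + b) T ->
  ble u v -> in_ideal T v -> in_ideal T u.
Proof.
move=> IT uv; have [incT _] := IT; have := increasing_ble incT uv.
by have := Inc_bounds u IT; rewrite /in_ideal; lia.
Qed.

Lemma above_corner_up a b (T : filling a b) (u v : box a b) :
  ble u v -> above_corner T u -> above_corner T v.
Proof.
move=> uv /existsP[c /andP[cc cu]]; apply/existsP; exists c.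
by rewrite cc (ble_trans cu uv).
Qed.

Lemma corner_above a b (T : filling a b) (u : box a b) :
  corner T u -> above_corner T u.
Proof. by move=> cu; apply/existsP; exists u; rewrite cu ble_refl. Qed.

Lemma above_corner_ideal a b (T : filling a b) (u : box a b) :
  in_ideal T u -> above_corner T u = corner T u.
Proof.
move=> Lu; apply/idP/idP => [|/corner_above //].
case/existsP=> c /andP[cc cu]; have /andP[_ /forallP/(_ u)] := cc.
by rewrite Lu cu => /eqP->.
Qed.

Lemma corner_in a b (T : filling a b) (u : box a b) :
  corner T u -> in_ideal T u.
Proof. by case/andP. Qed.

Lemma corner_succ a b (T : filling a b) (u v : box a b) : Inc (a + b) T ->
  corner T u -> ble u v -> rank v = (rank u).+1 -> ~~ in_ideal T v.
Proof.
move=> IT /andP[_ /forallP/(_ v)] + uv rv; rewrite uv andbT.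
case: (in_ideal T v) => //= /eqP e; move: rv; rewrite e; lia.
Qed.

Lemma not_corner_succ a b (T : filling a b) (u : box a b) : Inc (a + b) T ->
  in_ideal T u -> ~~ corner T u ->
  exists v, [/\ in_ideal T v, ble u v & rank v = (rank u).+1].
Proof.
move=> IT Lu; rewrite /corner Lu /= negb_forall => /existsP[w].
rewrite negb_imply => /andP[/andP[Lw uw] nuw].
rewrite eq_sym in nuw.
have [v [uv vw rv]] := ble_succ uw nuw.
by exists v; split=> //; apply: in_ideal_down vw Lw.
Qed.

(** Both kinds of active boxes, empty ones and ones holding the current label,
    are described by a single interval of times. *)
Lemma phase_active a b (T : filling a b) i (u : box a b) : Inc (a + b) T ->
  active i.+1 (phase T i) u = (T u <= i.+1 <= refill T u).
Proof.
move=> IT; have := Inc_bounds u IT; rewrite /active ffunE /refill.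
have someE m : (Some m == Some i.+1) = (m == i.+1) by [].
by case: ifP => ?; last case: ifP => ?; rewrite ?someE /=; lia.
Qed.

Lemma ex_succ a b (u : box a b) : (rank u).+2 < a + b ->
  exists2 v, ble u v & rank v = (rank u).+1.
Proof.
move=> ru.
have a1 : a.-1 < a by have := ltn_ord u.1; lia.
have b1 : b.-1 < b by have := ltn_ord u.2; lia.
have top : ble u (Ordinal a1, Ordinal b1).
  by rewrite /ble /=; have := ltn_ord u.1; have := ltn_ord u.2; lia.
have ntop : u != (Ordinal a1, Ordinal b1).
  by apply: contraTneq ru => ->; rewrite /rank /=; lia.
by have [v [uv _ rv]] := ble_succ top ntop; exists v.
Qed.

Lemma ex_pred a b (u : box a b) : 0 < rank u ->
  exists2 v, ble v u & rank u = (rank v).+1.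
Proof.
move=> ru.
have a0 : 0 < a by have := ltn_ord u.1; lia.
have b0 : 0 < b by have := ltn_ord u.2; lia.
have bot : ble (Ordinal a0, Ordinal b0) u by [].
have nbot : (Ordinal a0, Ordinal b0) != u.
  by apply: contraTneq ru => <-.
by have [v [_ vu rv]] := ble_pred bot nbot; exists v.
Qed.

Lemma refill_ge a b (T : filling a b) (u : box a b) :
  Inc (a + b) T -> T u <= refill T u.
Proof. by move/(Inc_bounds u); rewrite /refill; lia. Qed.

(** A box about to be emptied has a lower neighbour that is empty: in the
    ideal any lower neighbour will do, having been emptied one step earlier;
    outside the ideal take one lying on a chain down to a corner. *)
Lemma phase_enter a b (T : filling a b) i (u : box a b) :
  Inc (a + b) T -> 0 < i -> T u = i.+1 -> i.+1 < refill T u ->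
  exists2 v, T v <= i.+1 <= refill T v & adjacent u v.
Proof.
move=> IT i0 Tu iu; have := Inc_entry u IT.
case Lu: (in_ideal T u) => /= eu.
  have [v vu rv] : exists2 v, ble v u & rank u = (rank v).+1.
    by apply: ex_pred; lia.
  exists v; last by rewrite adjacentE vu rv eqxx orbT.
  have := Inc_entry v IT; rewrite (in_ideal_down IT vu Lu) /refill.
  by lia.
move: iu; rewrite /refill; case yu: (above_corner T u) => iu; last by lia.
case/existsP: yu => c /andP[cc cu].
have ncu : c != u by apply: contraFneq Lu => <-; apply: corner_in.
have [v [cv vu rv]] := ble_pred cu ncu.
exists v; last by rewrite adjacentE vu rv eqxx orbT.
have -> : above_corner T v by apply/existsP; exists c; rewrite cc.
by have := Inc_bounds v IT; lia.
Qed.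

(** A box that is never emptied lies outside the ideal and above no corner.  Its
    upper neighbours are then outside the ideal as well, so their labels come
    later; its lower neighbours are above no corner either, so they got their
    last labels earlier. *)
Lemma phase_isolated a b (T : filling a b) i (u v : box a b) : Inc (a + b) T ->
  T u = i.+1 -> refill T u = i.+1 -> adjacent u v ->
  ~~ (T v <= i.+1 <= refill T v).
Proof.
move=> IT Tu fu; rewrite adjacentE => uv; have := Inc_entry u IT; move: fu.
rewrite /refill; case yu: (above_corner T u) => fu.
  by have := Inc_bounds u IT; lia.
case Lu: (in_ideal T u) => /= eu; first by lia.
case/orP: uv => /andP[uv /eqP r].
  have := Inc_entry v IT.
  case Lv: (in_ideal T v) => /=; last by lia.
  by rewrite (in_ideal_down IT uv Lv) in Lu.
case yv: (above_corner T v); last by lia.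
by rewrite (above_corner_up uv yv) in yu.
Qed.

(** At the time foreseen for its refill, an upper neighbour of u holds the
    label i + 1: inside the ideal if u is in the ideal and not a corner, outside
    it otherwise.  The assumption i + 1 <= a + b excludes the last box, whose
    refill time would be a + b + 1, after the last step. *)
Lemma phase_leave a b (T : filling a b) i (u : box a b) :
  Inc (a + b) T -> i.+1 <= a + b -> T u <= i -> refill T u = i.+1 ->
  exists2 v, T v <= i.+1 <= refill T v & adjacent u v.
Proof.
move=> IT iab Tu fu; have Tuu := Inc_entry u IT.
case: (boolP (in_ideal T u && ~~ corner T u)) => [/andP[Lu cu]|nc].
  have [v [Lv uv rv]] := not_corner_succ IT Lu cu.
  exists v; last by rewrite adjacentE uv rv eqxx.
  have := Inc_entry v IT; rewrite Lv /=; move: fu.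
  by rewrite /refill (above_corner_ideal Lu) (negbTE cu); lia.
have fE : i = (rank u).+2.
  move: fu nc; rewrite /refill; move: Tuu.
  case: (boolP (in_ideal T u)) => Lu.
    by rewrite above_corner_ideal //; case: (corner T u) => //=; lia.
  by case: (above_corner T u) => /=; lia.
have [v uv rv] : exists2 v, ble u v & rank v = (rank u).+1.
  by apply: ex_succ; lia.
exists v; last by rewrite adjacentE uv rv eqxx.
suff Lv : ~~ in_ideal T v.
  by have := refill_ge v IT; have := Inc_entry v IT; rewrite Lv; lia.
case: (boolP (in_ideal T u)) nc => /= Lu.
  by rewrite negbK => cu; apply: corner_succ rv.
by move=> _; apply: contra Lu; apply: in_ideal_down.
Qed.

(** Only a corner stays empty through a step.  At that moment its lower
    neighbours have just been refilled, and its upper neighbours hold a label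
    still to come. *)
Lemma phase_stay a b (T : filling a b) i (u v : box a b) : Inc (a + b) T ->
  T u <= i -> i.+1 < refill T u -> adjacent u v ->
  ~~ (T v <= i.+1 <= refill T v).
Proof.
move=> IT Tu iu; rewrite adjacentE; have Tuu := Inc_entry u IT.
have [Lu cu fE] : [/\ in_ideal T u, corner T u & i = (rank u).+1].
  move: iu Tuu; rewrite /refill; case: (boolP (in_ideal T u)) => Lu.
    rewrite above_corner_ideal //=.
    case: (corner T u) => /= iu Tuu; last by lia.
    by split=> //; lia.
  by case: (above_corner T u) => /= iu Tuu; lia.
case/orP=> /andP[uv /eqP r].
  by have := Inc_entry v IT; rewrite (corner_succ IT cu uv r); lia.
have Lv := in_ideal_down IT uv Lu.
case cv: (corner T v).
  by have := corner_succ IT cv uv r; rewrite Lu.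
by have := Inc_entry v IT; rewrite /refill above_corner_ideal // Lv cv; lia.
Qed.

Lemma phase_step a b (T : filling a b) i : Inc (a + b) T -> 0 < i ->
  i.+1 <= a + b -> K_step (phase T i) i.+1 = phase T i.+1.
Proof.
move=> IT i0 iab; apply/ffunP => u; rewrite K_stepE phase_active //.
have -> : [exists y, active i.+1 (phase T i) y && adjacent u y]
        = [exists y, (T y <= i.+1 <= refill T y) && adjacent u y].
  by apply: eq_existsb => y; rewrite phase_active.
have fu := refill_ge u IT; rewrite !ffunE.
have exN : (forall v, adjacent u v -> ~~ (T v <= i.+1 <= refill T v)) ->
    [exists y, (T y <= i.+1 <= refill T y) && adjacent u y] = false.
  move=> H; apply/existsP => -[v /andP[vP /H]]; by rewrite vP.
have exY : (exists2 v, T v <= i.+1 <= refill T v & adjacent u v) ->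
    [exists y, (T y <= i.+1 <= refill T y) && adjacent u y].
  by case=> v vP uv; apply/existsP; exists v; rewrite vP.
have [Tu|Tu|Tu] := ltngtP (T u) i.+1; rewrite /=.
- have [iu|iu] := leqP (refill T u) i.
    by have -> : (i.+1 < refill T u) = false by lia.
  have [iu'|iu'] := ltnP i.+1 (refill T u).
    by rewrite exN // => v; apply: phase_stay.
  have eu : refill T u = i.+1 by lia.
  by rewrite exY ?eu //; apply: phase_leave.
- by [].
- have [iu|iu] := ltnP i.+1 (refill T u).
    by rewrite ltnW // exY //; apply: phase_enter.
  have eu : refill T u = i.+1 by lia.
  rewrite exN ?andbF ?Tu ?eu // => v; exact: phase_isolated.
Qed.

(** * K-promotion is inverse rowmotion *)

Lemma foldl_phase a b (T : filling a b) n : Inc (a + b) T -> n < a + b ->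
  foldl (@K_step a b) (delete_ones T) (iota 2 n) = phase T n.+1.
Proof.
move=> IT; elim: n => [_|n IHn ltn].
  apply/ffunP => u; rewrite !ffunE /refill; have := Inc_bounds u IT.
  have [->|Tu] := eqVneq (T u) 1; first by [].
  by move=> bu; have -> : 1 < T u by lia.
rewrite -{1}(addn1 n) iotaD foldl_cat IHn; last exact: ltnW.
by rewrite /= add2n phase_step.
Qed.

Lemma K_ProE a b (T : filling a b) (u : box a b) : Inc (a + b) T ->
  K_Pro (a + b) T u = (rank u).+1 + above_corner T u.
Proof.
move=> IT; have a0 : 0 < a by have := ltn_ord u.1; lia.
have b0 : 0 < b by have := ltn_ord u.2; lia.
have ru := rank_lt u.
rewrite ffunE foldl_phase //; last by lia.
have [_ /(_ u) Tu] := IT.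
rewrite prednK ?addn_gt0 ?a0 // ffunE ltnNge Tu /= /refill.
by case: ifP => /= ?; lia.
Qed.

Lemma Inc_rank a b (x : pred (box a b)) :
  (forall u v, ble u v -> x u -> x v) ->
  Inc (a + b) ([ffun u => (rank u).+1 + x u] : filling a b).
Proof.
move=> mono; split; [split|].
- by move=> u; rewrite ffunE.
- move=> r c c' ltc; rewrite !ffunE /rank /=.
  have := mono (r, c) (r, c'); rewrite /ble /=.
  by case: (x (r, c)) => [->|_]; lia.
- move=> r r' c ltr; rewrite !ffunE /rank /=.
  have := mono (r, c) (r', c); rewrite /ble /=.
  by case: (x (r, c)) => [->|_]; lia.
- by move=> u; rewrite ffunE; have := rank_lt u; lia.
Qed.

Lemma Inc_K_Pro a b (T : filling a b) : Inc (a + b) T ->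
  Inc (a + b) (K_Pro (a + b) T).
Proof.
move=> IT.
have -> : K_Pro (a + b) T = [ffun u => (rank u).+1 + above_corner T u].
  by apply/ffunP => u; rewrite K_ProE // ffunE.
exact/Inc_rank/above_corner_up.
Qed.

Lemma in_ideal_K_Pro a b (T : filling a b) (u : box a b) : Inc (a + b) T ->
  in_ideal (K_Pro (a + b) T) u = ~~ above_corner T u.
Proof. by move=> IT; rewrite /in_ideal K_ProE //; lia. Qed.

(** * Row lengths of the ideal *)

Definition rowlen a b (T : filling a b) (i : nat) : nat :=
  \max_(u : box a b | (u.1 == i :> nat) && in_ideal T u) u.2.+1.

Lemma rowlen_le a b (T : filling a b) i : rowlen T i <= b.
Proof. by apply/bigmax_leqP => u _; apply: ltn_ord. Qed.

Lemma rowlen_out a b (T : filling a b) i : a <= i -> rowlen T i = 0.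
Proof.
move=> ai; apply: big_pred0 => u.
by have := ltn_ord u.1; case: eqP => //=; lia.
Qed.

Lemma in_idealE a b (T : filling a b) (u : box a b) : Inc (a + b) T ->
  in_ideal T u = (u.2 < rowlen T u.1).
Proof.
move=> IT; apply/idP/idP => [Lu|].
  by rewrite /rowlen (bigmax_sup u) // eqxx.
apply: contraTT => Lu; rewrite -leqNgt.
apply/bigmax_leqP => v /andP[/eqP vu Lv].
rewrite ltnNge; apply: contra Lu => uv; apply: in_ideal_down Lv => //.
by rewrite /ble vu leqnn.
Qed.

Lemma rowlen_anti a b (T : filling a b) i k : Inc (a + b) T ->
  i <= k -> rowlen T k <= rowlen T i.
Proof.
move=> IT ik; apply/bigmax_leqP => v /andP[/eqP vk Lv].
have ia : i < a by apply: leq_ltn_trans ik _; rewrite -vk.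
have Lu : in_ideal T (Ordinal ia, v.2).
  by apply: in_ideal_down Lv => //; rewrite /ble /= vk ik leqnn.
by rewrite in_idealE in Lu.
Qed.

Definition descent a b (T : filling a b) (i : nat) : bool :=
  rowlen T i.+1 < rowlen T i.

Lemma cornerE a b (T : filling a b) (u : box a b) : Inc (a + b) T ->
  corner T u = descent T u.1 && (rowlen T u.1 == u.2.+1).
Proof.
move=> IT; rewrite /corner /descent in_idealE //.
apply/idP/idP => [/andP[Lu /forallP maxu]|].
  have row : rowlen T u.1 <= u.2.+1.
    rewrite leqNgt; apply/negP => lt.
    have jb : u.2.+1 < b by apply: leq_trans lt (rowlen_le _ _).
    have := maxu (u.1, Ordinal jb).
    rewrite in_idealE // /ble /= lt leqnn leqnSn /=.
    by move/eqP/(congr1 (fun v : box a b => v.2 : nat)) => /=; lia.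
  suff col : rowlen T u.1.+1 <= u.2 by lia.
  rewrite leqNgt; apply/negP => lt.
  have ia : u.1.+1 < a.
    by rewrite ltnNge; apply: contraTN lt => ai; rewrite rowlen_out.
  have := maxu (Ordinal ia, u.2).
  rewrite in_idealE // /ble /= lt leqnn leqnSn /=.
  by move/eqP/(congr1 (fun v : box a b => v.1 : nat)) => /=; lia.
case/andP=> des /eqP row; rewrite row ltnSn /=; apply/forallP => -[k l].
apply/implyP; rewrite in_idealE // /ble /= => /and3P[Lv uk ul].
have [lt1|ge1] := ltnP u.1 k.
  by have := rowlen_anti IT lt1; lia.
have ek : k = u.1 :> nat by lia.
by apply/eqP/box_eq => //=; move: Lv; rewrite ek row; lia.
Qed.

(** Rowmotion in terms of row lengths: the column bounding row i of the new
    ideal is the leftmost one holding a corner of T in rows 0, ..., i.  The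
    three lemmas that follow turn this into a recursion on i. *)
Lemma rowlen_K_Pro_leP a b (T : filling a b) i j : Inc (a + b) T ->
  i < a -> j < b ->
  reflect (exists k, [/\ k <= i, descent T k & rowlen T k <= j.+1])
          (rowlen (K_Pro (a + b) T) i <= j).
Proof.
move=> IT ia jb.
have -> : (rowlen (K_Pro (a + b) T) i <= j)
        = above_corner T (Ordinal ia, Ordinal jb).
  have := in_idealE (Ordinal ia, Ordinal jb) (Inc_K_Pro IT).
  rewrite (in_ideal_K_Pro _ IT) => /(congr1 negb).
  by rewrite negbK -leqNgt => ->.
apply: (iffP existsP) => [[c]|[k [ki dk lk]]].
  rewrite cornerE // /ble /= => /andP[/andP[dc /eqP lc] /andP[ci cj]].
  by exists c.1; rewrite lc.
have ka : k < a by lia.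
have lb : (rowlen T k).-1 < b by have := rowlen_le T k; lia.
exists (Ordinal ka, Ordinal lb); rewrite cornerE // dk /ble /= ki.
by move: dk; rewrite /descent; lia.
Qed.

Lemma rowlen_K_Pro_descent a b (T : filling a b) i : Inc (a + b) T ->
  i < a -> descent T i -> rowlen (K_Pro (a + b) T) i = (rowlen T i).-1.
Proof.
move=> IT ia di; have lb := rowlen_le T i; have := di; rewrite /descent => di'.
apply/eqP; rewrite eqn_leq; apply/andP; split.
  by apply/rowlen_K_Pro_leP => //; [lia|exists i; split=> //; lia].
rewrite leqNgt; apply/negP => lt.
have /rowlen_K_Pro_leP : rowlen (K_Pro (a + b) T) i <= (rowlen T i).-2 by lia.
case=> //; first by lia.
by move=> k [ki dk lk]; have := rowlen_anti IT ki; lia.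
Qed.

Lemma rowlen_K_Pro_flat a b (T : filling a b) i : Inc (a + b) T ->
  i.+1 < a -> ~~ descent T i.+1 ->
  rowlen (K_Pro (a + b) T) i.+1 = rowlen (K_Pro (a + b) T) i.
Proof.
move=> IT ia di; have IT' := Inc_K_Pro IT.
apply/eqP; rewrite eqn_leq rowlen_anti //=.
have [lb|bl] := ltnP (rowlen (K_Pro (a + b) T) i.+1) b; last first.
  exact: leq_trans (rowlen_le _ _) bl.
have /rowlen_K_Pro_leP := leqnn (rowlen (K_Pro (a + b) T) i.+1).
case=> // k [ki dk lk]; apply/rowlen_K_Pro_leP => //; first by lia.
exists k; split=> //; rewrite -ltnS ltn_neqAle ki andbT.
by apply: contraNneq di => <-.
Qed.

Lemma rowlen_K_Pro_first a b (T : filling a b) : Inc (a + b) T -> 0 < a ->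
  ~~ descent T 0 -> rowlen (K_Pro (a + b) T) 0 = b.
Proof.
move=> IT a0 d0; apply/eqP; rewrite eqn_leq rowlen_le leqNgt; apply/negP => lb.
have /rowlen_K_Pro_leP := leqnn (rowlen (K_Pro (a + b) T) 0).
by case=> // k []; rewrite leqn0 => /eqP->; rewrite (negbTE d0).
Qed.

(** * The word of a tableau rotates *)

Definition column_corner a b (T : filling a b) (j : nat) : bool :=
  [exists k : 'I_a, rowlen T k == j.+1].

(** Column j contains a corner as soon as some row has length j + 1: go down
    to the last row of that length. *)
Lemma column_cornerP a b (T : filling a b) j : Inc (a + b) T ->
  reflect (exists k, [/\ k < a, descent T k & rowlen T k = j.+1])
          (column_corner T j).
Proof.
move=> IT; apply: (iffP existsP) => [[k /eqP lk]|[k [ka _ lk]]]; last first.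
  by exists (Ordinal ka); rewrite lk.
have [n] := ubnP (a - k); elim: n (k : nat) lk => // n IHn i li an.
have ia : i < a by rewrite ltnNge; apply/negP => /(rowlen_out T); lia.
have [di|ndi] := boolP (descent T i); first by exists i.
apply: (IHn i.+1); last by lia.
by have := rowlen_anti IT (leqnSn i); move: ndi; rewrite /descent; lia.
Qed.

(** The Stanley-Thomas word of the antichain of corners.  The column letters are
    negated so that the rotation carries row letters to column letters without
    change. *)
Definition word a b (T : filling a b) (k : nat) : bool :=
  if k < a then descent T k else ~~ column_corner T (k - a).

Lemma word_K_Pro a b (T : filling a b) k : Inc (a + b) T -> 0 < a -> 0 < b ->
  k < a + b -> word (K_Pro (a + b) T) k = word T (k.+1 %% (a + b)).
Proof.
move=> IT a0 b0 kab; have IT' := Inc_K_Pro IT.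
have [kl|kl] := ltnP k.+1 (a + b); last first.
  have -> : k.+1 = a + b by lia.
  (* The new row 0 reaches the last column exactly when no corner of T lies in
     row 0 to push it back. *)
  rewrite modnn /word a0.
  have -> : (k < a) = false by lia.
  have -> : k - a = b.-1 by lia.
  apply/negP/idP => [nC|d0].
    apply/negPn/negP => /(rowlen_K_Pro_first IT a0) l0; apply: nC.
    by apply/existsP; exists (Ordinal a0); rewrite /= l0 prednK.
  case/existsP=> i /eqP; have := rowlen_anti IT' (leq0n i).
  have := rowlen_K_Pro_descent IT a0 d0; have := rowlen_le T 0; lia.
rewrite modn_small // /word.
have [k1a|ak1] := ltnP k.+1 a.
  (* Row k + 1 becomes shorter than row k exactly when it has a corner of its
     own; otherwise the same corner of T, or the edge of the rectangle, bounds
     both rows. *)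
  rewrite ltnW //; rewrite {1}/descent.
  have [d|nd] := boolP (descent T k.+1); last first.
    by rewrite rowlen_K_Pro_flat ?ltnn.
  rewrite rowlen_K_Pro_descent // ltnNge; apply/negP => le.
  have lb := rowlen_le T k.+1.
  have d' := d; rewrite /descent in d'.
  have /rowlen_K_Pro_leP := le; case=> //; [by lia|by lia|].
  move=> m [mk dm lm]; have := rowlen_anti IT mk.
  move: dm; rewrite /descent; have := @rowlen_anti _ _ T m.+1 k.+1 IT mk.
  by lia.
have [ka|ak] := ltnP k a.
  have ek : k.+1 = a by lia.
  (* The new last row is empty exactly when T has a corner in column 0. *)
  rewrite ek subnn /descent ek rowlen_out // lt0n -leqn0.
  congr (~~ _); apply/rowlen_K_Pro_leP/column_cornerP => //.
    case=> m [mk dm lm]; exists m; split=> //; first by lia.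
    by move: dm; rewrite /descent; lia.
  by case=> m [ma dm lm]; exists m; split=> //; lia.
(* A corner of T in column j + 1 gives its row the new length j + 1. *)
congr (~~ _); rewrite subSn //.
apply/existsP/column_cornerP => // [[i /eqP li]|[m [ma dm lm]]].
  have := leqnn (rowlen (K_Pro (a + b) T) i); rewrite {2}li.
  case/rowlen_K_Pro_leP => //; first by lia.
  move=> m [mi dm lm]; exists m; split=> //; first by have := ltn_ord i; lia.
  apply/eqP; rewrite eqn_leq lm ltnNge; apply/negP => lm'.
  have : rowlen (K_Pro (a + b) T) i <= k - a.
    by apply/rowlen_K_Pro_leP => //; [lia|exists m].
  by rewrite li ltnn.
by exists (Ordinal ma); rewrite /= rowlen_K_Pro_descent // lm.
Qed.

Lemma word_iter_K_Pro a b (T : filling a b) m k : Inc (a + b) T ->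
  0 < a -> 0 < b -> k < a + b ->
  word (iter m (@K_Pro (a + b) a b) T) k = word T ((k + m) %% (a + b)).
Proof.
move=> IT a0 b0; elim: m T IT k => [|m IHm] T IT k kab.
  by rewrite addn0 modn_small.
rewrite iterSr IHm //; last exact: Inc_K_Pro.
have ab0 : 0 < a + b by lia.
rewrite word_K_Pro // ?ltn_pmod //.
by rewrite -addn1 modnDml addn1 addnS.
Qed.

(** Suppose that row i is longer in T than in S, while rows i + 1 agree.  Then
    both tableaux have a corner in row i, since T does; the corner of S forces
    one of T in the same column, that is, a row of T with the length of row i
    of S.  But the rows of T up to i are longer than that, and those below i
    are shorter. *)
Lemma rowlen_leq_word a b (S T : filling a b) i :
  Inc (a + b) S -> Inc (a + b) T -> i < a ->
  (forall k, k < a + b -> word S k = word T k) ->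
  rowlen S i.+1 = rowlen T i.+1 -> rowlen T i <= rowlen S i.
Proof.
move=> IS IT ia eqw eqi; rewrite leqNgt; apply/negP => lt.
have eqd : descent S i = descent T i.
  by have := eqw i; rewrite /word ia ltn_addr //; apply.
have dS : descent S i.
  by rewrite eqd /descent -eqi; apply: leq_ltn_trans lt; apply: rowlen_anti.
have := dS; rewrite /descent => dS'.
have lb := rowlen_le S i.
have : column_corner S (rowlen S i).-1.
  by apply/existsP; exists (Ordinal ia); rewrite /= prednK //; lia.
have -> : column_corner S (rowlen S i).-1 = column_corner T (rowlen S i).-1.
  apply: negb_inj; have := eqw (a + (rowlen S i).-1).
  by rewrite /word (ltnNge _ a) leq_addr /= addKn; apply; lia.
case/existsP=> k /eqP lk; have [ik|ki] := ltnP i k.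
  by have := rowlen_anti IT ik; lia.
by have := rowlen_anti IT ki; lia.
Qed.

Lemma word_inj a b (S T : filling a b) : Inc (a + b) S -> Inc (a + b) T ->
  (forall k, k < a + b -> word S k = word T k) -> S = T.
Proof.
move=> IS IT eqw.
have eql i : rowlen S i = rowlen T i.
  have [n] := ubnP (a - i); elim: n i => // n IHn i an.
  have [ai|ia] := leqP a i; first by rewrite !rowlen_out.
  have e1 : rowlen S i.+1 = rowlen T i.+1 by apply: IHn; lia.
  by apply/eqP; rewrite eqn_leq !rowlen_leq_word // => k /eqw.
apply/ffunP => u.
by rewrite (Inc_entry u IS) (Inc_entry u IT) !in_idealE // eql.
Qed.

(** The tableau whose ideal is empty; the summand true stands for the largest
    admissible excess over rank u + 1. *)
Definition empty_tableau a b : filling a b := [ffun u => (rank u).+1 + true].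

Lemma word_empty_tableau a b k : word (empty_tableau a b) k = (a <= k).
Proof.
have l0 i : rowlen (empty_tableau a b) i = 0.
  by apply: big_pred0 => u; rewrite /in_ideal ffunE; lia.
rewrite /word /descent !l0 ltnn (leqNgt a k); case: (k < a) => //=.
by apply/negP => /existsP[i]; rewrite l0.
Qed.

(** A rotation by m < a + b puts the junction between the last and the first
    letter strictly inside the word, where it would be a descent from true to
    false. *)
Lemma rotation_period a b m : 0 < a -> 0 < b -> 0 < m ->
  (forall k, k < a + b -> (a <= (k + m) %% (a + b)) = (a <= k)) -> a + b <= m.
Proof.
move=> a0 b0 m0 per; rewrite leqNgt; apply/negP => mab.
have := per (a + b - m); rewrite subnK ?modnn; last by lia.
have := per (a + b - m).-1.
have -> : (a + b - m).-1 + m = (a + b).-1 by lia.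
rewrite modn_small; last by lia.
by lia.
Qed.

Theorem corollary4p9 (a b : nat) (ha : 1 <= a) (hb : 1 <= b) :
  has_order_on (@Inc (a + b) a b) (@K_Pro (a + b) a b) (a + b).
Proof.
have Inc_iter m (T : filling a b) :
    Inc (a + b) T -> Inc (a + b) (iter m (@K_Pro (a + b) a b) T).
  by move=> IT; elim: m => //= m; apply: Inc_K_Pro.
split=> [|T IT|m m0 idm]; first by lia.
  apply: word_inj => // [|k kab]; first exact: Inc_iter.
  by rewrite word_iter_K_Pro // modnDr modn_small.
have I0 : Inc (a + b) (empty_tableau a b) by apply: Inc_rank.
apply: rotation_period => // k kab.
by rewrite -!(word_empty_tableau a b) -word_iter_K_Pro // idm.
Qed.
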